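(* Let $(\mathcal{X},d)$ be a Polish metric space with $\operatorname{diam}(\mathcal{X})\le 1$, let $\kappa\in(0,1)$, and let $P$ be a Markov kernel on $\mathcal{X}$ such that $W_1(P^n(x,\cdot),P^n(y,\cdot))\le\kappa^n d(x,y)$ for all $n\in\mathbb{N}$ and $x,y\in\mathcal{X}$. Let $(X_n)_{n\ge0}$ be a time-homogeneous Markov chain on $\mathcal{X}$ with kernel $P$, let $\mu$ be its invariant probability measure, let $\mu_n=\frac1n\sum_{i=1}^n\delta_{X_i}$ for $n\in\mathbb{N}$, and let $S\subseteq\operatorname{Lip}_1(\mathcal{X})$ be an arbitrary class of functions. Then for all $n\in\mathbb{N}$ and $t\ge0$, $$\mathbb{P}\big(d_S(\mu,\mu_n)\ge\mathbb{E}[d_S(\mu,\mu_n)]+t\big)\le\exp\big(-2(1-\kappa)^2\,n\,t^2\big).$$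
   Context: $\mathbb{N}=\{1,2,\dots\}$. $\operatorname{Lip}_1(\mathcal{X})$ is the set of $1$-Lipschitz functions $\mathcal{X}\to\mathbb{R}$; $W_1$ is the $1$-Wasserstein distance on $\mathcal{X}$ with respect to $d$; $P^n$ is the $n$-fold iterate of $P$. The contraction hypothesis implies that $P$ has a unique invariant probability measure $\mu$ with finite first moment ($\mu P=\mu$). For probability measures $\mu,\nu$ with finite first moment, $d_S(\mu,\nu)=\sup_{f\in S}|\mu(f)-\nu(f)|$, where $\mu(f)=\int f\,d\mu$. *)

(* Defs.v *)
From HB Require Import structures.
From mathcomp Require Import all_boot all_order all_algebra.
From mathcomp Require Import all_classical all_reals all_analysis.

Set Implicit Arguments.
Unset Strict Implicit.
Unset Printing Implicit Defensive.
Import Order.TTheory GRing.Theory Num.Theory.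
Import numFieldNormedType.Exports.

Local Open Scope classical_set_scope.
Local Open Scope ring_scope.

(* Complete separable metric spaces, equipped with their Borel sigma-algebra.
   As for every [measurableType], the carrier is nonempty. *)
HB.mixin Record isPolishBorel d (R : realType) T
    & Metric R T & Complete T & Measurable d T := {
  polish_separable : exists2 D : set T, countable D & dense D ;
  polish_borel : (measurable : set (set T)) = <<s [set U : set T | open U] >>
}.

#[short(type="polishType")]
HB.structure Definition Polish d (R : realType) :=
  {T of Metric R T & Complete T & Measurable d T & isPolishBorel d R T}.

Section metric.
Context {d : measure_display} {R : realType} (T : polishType d R).

Definition diameter : \bar R :=
  ereal_sup [set (mdist z.1 z.2)%:E | z in [set: T * T]].

Definition Lip1 : set (T -> R) :=
  [set f | forall x y, `|f x - f y| <= mdist x y].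

End metric.
Arguments diameter {d R} T.
Arguments Lip1 {d R} T.

Section distances.
Context {d : measure_display} {R : realType} {T : polishType d R}.
Local Open Scope ereal_scope.

Definition coupling (mu nu : {measure set T -> \bar R}) :
    set (probability (T * T)%type R) :=
  [set pi | (forall A, measurable A -> pi (A `*` [set: T]) = mu A) /\
            (forall A, measurable A -> pi ([set: T] `*` A) = nu A)].

Definition W1 (mu nu : {measure set T -> \bar R}) : \bar R :=
  ereal_inf [set \int[pi]_z (mdist z.1 z.2)%:E | pi in coupling mu nu].

(* The supremum is the one of [R], so the distance is 0 for the empty class.
   It is meant for S contained in [Lip1 T] and for probability measures with
   finite first moment: each integral and the supremum are then finite. *)
Definition dS (S : set (T -> R)) (mu nu : {measure set T -> \bar R}) : R :=
  sup [set `|\int[mu]_x f x - \int[nu]_x f x|%R | f in S].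

(* The empirical measure of x 1, ..., x n; the point x 0 is not used. *)
Definition empirical (n : nat) (x : nat -> T) : {measure set T -> \bar R} :=
  mscale ((n%:R^-1)%:nng)%R (msum (fun i => \d_(x i.+1)) n).

End distances.

Section pker_comp.
Context d0 d1 d2 (T0 : measurableType d0) (T1 : measurableType d1)
  (T2 : measurableType d2) (R : realType)
  (k1 : R.-pker T0 ~> T1) (k2 : R.-pker T1 ~> T2).
Local Open Scope ereal_scope.

Let prob_kernel_comp x : mkcomp_noparam k1 k2 x [set: T2] = 1.
Proof.
rewrite /mkcomp_noparam /= /kcomp_noparam.
under eq_integral do rewrite prob_kernel.
by rewrite integral_cst// mul1e prob_kernel.
Qed.

HB.instance Definition _ := isProbabilityKernel.Build _ _ _ _ R
  (mkcomp_noparam k1 k2) prob_kernel_comp.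

End pker_comp.

Section markov.
Context {d : measure_display} {T : measurableType d} {R : realType}.
Local Open Scope ereal_scope.

Fixpoint kiter (P : R.-pker T ~> T) (n : nat) : R.-pker T ~> T :=
  if n is m.+1 then mkcomp_noparam P (kiter P m)
  else kdirac (@measurable_id _ T [set: T]).

Definition invariant_measure (P : R.-pker T ~> T) (mu : probability T R) :=
  forall A, measurable A -> \int[mu]_x P x A = mu A.

Context {d' : measure_display} {Omega : measurableType d'}.

Definition past (X : nat -> Omega -> T) (n : nat) : set_system Omega :=
  <<s \bigcup_(i in `I_n.+1) preimage_set_system [set: Omega] (X i) measurable >>.

(* P (X_n, A) is a version of the conditional probability of X_{n+1} \in A
   given the sigma-algebra generated by X_0, ..., X_n; the law of X_0 is
   arbitrary. *)
Definition markov_chain (Pr : probability Omega R) (P : R.-pker T ~> T)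
    (X : nat -> {RV Pr >-> T}) :=
  forall (n : nat) (H : set Omega) (A : set T),
    past X n H -> measurable A ->
    Pr (H `&` X n.+1 @^-1` A) = \int[Pr]_(w in H) P (X n w) A.

End markov.

(* Main.v *)
Require Import Defs.
From HB Require Import structures.
From mathcomp Require Import all_boot all_order all_algebra.
From mathcomp Require Import all_classical all_reals all_analysis.
From mathcomp Require Import measurable_realfun ring lra.

Import Order.TTheory GRing.Theory Num.Theory.
Import numFieldNormedType.Exports.

Set Implicit Arguments.
Unset Strict Implicit.

Local Open Scope classical_set_scope.
Local Open Scope ring_scope.

(** The distance [dS S mu (empirical n x)] is a function of [n] points which
    moves by at most [d(x_i, y_i) / n] when its [i]-th point moves from [x_i]
    to [y_i], so the statement is an inequality of McDiarmid type for a
    contracting Markov chain, and it is proved by the martingale method.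

    Call [F] coordinate-Lipschitz with weights [a] when [|F x - F y|] is at
    most the weighted sum of the [d(x_i, y_i)] ([coord_lip]).  Averaging out
    the last coordinate along the kernel gives
    [A F (x_0 .. x_k) = \int F (x_0 .. x_k, y) P(x_k, dy)] ([next_mean]).
    Besides the explicit dependence on [x_k], of weight [a_k], the mean depends
    on [x_k] through the law of [y]; by the easy half of Kantorovich duality
    ([Rintegral_sub_le_W1]) and the contraction of [P] this costs
    [kappa * a_(k+1)].  Hence the weight of the newest coordinate becomes
    [a_k + kappa * a_(k+1)] ([next_mean_lip]), and starting from the constant
    weight [alpha = 1 / n] it never exceeds the geometric sum
    [c = alpha / (1 - kappa)].

    As the diameter is at most 1, each of these functions has oscillation at
    most [c] in its last coordinate, so that Hoeffding's lemma
    ([hoeffding_mgf]) bounds the mean of [exp (l * F)] over that coordinate by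
    [exp (l * A F + l^2 c^2 / 8)].  The tower property ([disintegration])
    then removes one coordinate at a time, each at the price of a factor
    [exp (l^2 c^2 / 8)] ([markov_mgf]).  Chernoff's bound with the optimal
    [l = 4 t / (n c^2)] gives [exp (- 2 t^2 / (n c^2))], which is the claim.

    The count of factors must be exactly [n], whereas the chain has the extra
    initial point [X_0].  The shifted chain [Y_i = X_(i+1)] is again a Markov
    chain with kernel [P] and an arbitrary initial law, and its first
    coordinate is handled by Hoeffding's lemma for the law of [Y_0].

    Trajectories are plain functions [nat -> T], without any sigma-algebra on
    them: a coordinate-Lipschitz function is determined by its values on the
    countably many sequences extracted from a dense sequence, and this yields
    both its measurability along any measurable process
    ([measurable_coord_lip]) and the tower property, by cutting the past into
    countably many cells on which it is almost constant ([past_cells]). *)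

(** * Hoeffding's lemma *)

Section scalar.
Context {R : realType}.
Implicit Types (p u x : R).

Lemma two_point_mgf_gt0 p u : 0 <= p <= 1 -> 0 < (1 - p) + p * expR u.
Proof.
move=> /andP[p0 p1]; have := expR_gt0 u => eu.
have [->|pN0] := eqVneq p 0; first by rewrite mul0r subr0 addr0.
by rewrite ltr_wpDl ?subr_ge0// mulr_gt0// lt_neqAle eq_sym pN0.
Qed.

Lemma ge0_derive_ge (f f' : R -> R) u :
  (forall x, is_derive x 1 f (f' x)) -> (forall x, 0 <= x -> 0 <= f' x) ->
  0 <= u -> f 0 <= f u.
Proof.
move=> df f'0 u0.
apply: (@ger0_derive1_ndecry R f 0) => //.
- by move=> x; rewrite in_itv/= andbT => /ltW x0; rewrite derive1E derive_val f'0.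
- apply: continuous_subspaceT => x.
  by apply: differentiable_continuous; apply/derivable1_diffP.
Qed.

(** The moment generating function of a Bernoulli law.  Its logarithm has
    derivative the mean [q x] of the exponentially tilted law, and
    [q' = q (1 - q) <= 1/4] makes [q x] grow at most like [p + x / 4]; the
    bound follows by integrating twice. *)
Lemma two_point_mgf_le p u : 0 <= p <= 1 -> 0 <= u ->
  (1 - p) + p * expR u <= expR (p * u + u ^+ 2 / 8).
Proof.
move=> p01 u0.
have d0 x := @two_point_mgf_gt0 p x p01.
pose m x : R := (1 - p) + p * expR x.
pose q x : R := p * expR x * (m x)^-1.
have dm x : is_derive x 1 m (p * expR x).
  by apply: is_derive_eq; rewrite /GRing.scale/=; ring.
have m0 x : m x != 0 by rewrite gt_eqF// d0.
have dq x : is_derive x 1 q (q x * (1 - q x)).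
  have dmV : is_derive x 1 (fun y => (m y)^-1) (- (m x) ^- 2 *: (p * expR x)).
    exact: is_deriveV.
  apply: is_derive_eq; rewrite /GRing.scale/= /q.
  have := m0 x; move: (m x) (expR x) => a b a0; field.
  by [].
have q_le x : 0 <= x -> q x <= p + x / 4.
  move=> x0; rewrite -subr_ge0.
  have -> : 0 = (fun y => p + y / 4 - q y) 0.
    by rewrite /= /q /m expR0 mulr1 subrK invr1 mulr1 mul0r addr0 subrr.
  pose f' y : R := 4^-1 - q y * (1 - q y).
  apply: (@ge0_derive_ge (fun y => p + y / 4 - q y) f') => //.
    by move=> y; apply: is_derive_eq; rewrite /f' /GRing.scale/=; ring.
  move=> y _; rewrite /f'.
  have -> : 4^-1 - q y * (1 - q y) = (2^-1 - q y) ^+ 2 by field.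
  exact: sqr_ge0.
pose g x : R := expR (p * x + x ^+ 2 / 8) * (m x)^-1.
suff : g 0 <= g u.
  rewrite {1}/g /m mulr0 expr0n mul0r addr0 expR0 mulr1 subrK invr1 mulr1.
  by rewrite /g ler_pdivlMr ?d0// mul1r.
apply: (@ge0_derive_ge g (fun x => g x * (p + x / 4 - q x))) => //; last first.
  move=> x x0; rewrite mulr_ge0 ?subr_ge0 ?q_le//.
  by rewrite /g divr_ge0 ?expR_ge0// ltW// d0.
move=> x.
have dmV : is_derive x 1 (fun y => (m y)^-1) (- (m x) ^- 2 *: (p * expR x)).
  exact: is_deriveV.
have dE : is_derive x 1 (fun y => expR (p * y + y ^+ 2 / 8))
    (expR (p * x + x ^+ 2 / 8) * (p + x / 4)).
  have dI : is_derive x 1 (fun y : R => p * y + y ^+ 2 / 8) (p + x / 4).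
    by apply: is_derive_eq; rewrite /GRing.scale/=; field.
  apply: (@is_derive1_comp R expR (fun y : R => p * y + y ^+ 2 / 8)).
apply: is_derive_eq; rewrite /GRing.scale/= /g /q.
have := m0 x; move: (m x) (expR x) (expR (_ + _)) => a b e a0; field.
by [].
Qed.
End scalar.

Section hoeffding.
Context {R : realType}.

(** Both endpoints of the chord lie above the tangent to [exp] at [u * s]. *)
Lemma expR_le_chord (s u : R) : 0 <= s <= 1 ->
  expR (u * s) <= (1 - s) + s * expR u.
Proof.
move=> /andP[s0 s1].
have h0 : expR (u * s) * (1 - u * s) <= 1.
  have := expR_ge1Dx (- (u * s)).
  by move=> /(ler_wpM2l (expR_ge0 (u * s))); rewrite -expRD subrr expR0.
have h1 : expR (u * s) * (1 + u * (1 - s)) <= expR u.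
  have := expR_ge1Dx (u * (1 - s)).
  move=> /(ler_wpM2l (expR_ge0 (u * s))); rewrite -expRD.
  by rewrite -mulrDr (addrC s) subrK mulr1.
have h2 : (1 - s) * (expR (u * s) * (1 - u * s)) <= 1 - s.
  by rewrite -[leRHS]mulr1 ler_wpM2l// subr_ge0.
have h3 : s * (expR (u * s) * (1 + u * (1 - s))) <= s * expR u.
  by rewrite ler_wpM2l.
rewrite (le_trans _ (lerD h2 h3))// le_eqVlt; apply/orP; left; apply/eqP.
ring.
Qed.

Context d (T : measurableType d) (m : {measure set T -> \bar R}).
Hypothesis m1 : m setT = 1%E.

Lemma integrable_of_bounded (f : T -> R) (M : R) :
  measurable_fun setT f -> (forall x, `|f x| <= M) ->
  m.-integrable setT (EFin \o f).
Proof.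
move=> mf fM; apply: measurable_bounded_integrable => //.
  by rewrite m1 ltry.
by exists M; split; [exact: num_real|move=> N MN x _ /=; rewrite (le_trans (fM x))// ltW].
Qed.

Lemma Rintegral_prob_cst (c : R) : \int[m]_x c = c.
Proof. by rewrite Rintegral_cst// m1/= mulr1. Qed.

Lemma bounded_of_oscillation (f : T -> R) (c : R) :
  (forall x y, f x - f y <= c) -> forall x, `|f x| <= `|f point| + c.
Proof.
move=> fc x; have -> : f x = f point + (f x - f point) by rewrite addrC subrK.
by rewrite (le_trans (ler_normD _ _))// lerD2l ler_norml fc lerNl opprB fc.
Qed.

(** By convexity [exp (l f)] lies below the chord over the range of [f]; the
    integral of the chord is the two-point case with [p] the relative position
    of the mean in that range. *)
Lemma hoeffding_mgf (f : T -> R) (c l : R) : 0 < c -> 0 <= l ->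
  measurable_fun setT f -> (forall x y, f x - f y <= c) ->
  \int[m]_x expR (l * f x) <= expR (l * \int[m]_x f x + (l * c) ^+ 2 / 8).
Proof.
move=> c0 l0 mf fc.
have fB := bounded_of_oscillation fc.
pose a := inf (range f).
have rf0 : range f !=set0 by exists (f point), point.
have fa x : a <= f x.
  apply: ge_inf; last by exists x.
  by exists (f x - c) => _ [y _ <-]; rewrite lerBlDr addrC -lerBlDr fc.
have af x : f x <= a + c.
  rewrite -lerBlDr; apply: lb_le_inf => // _ [y _ <-].
  by rewrite lerBlDr addrC -lerBlDr fc.
pose g x := (f x - a) / c.
have g01 x : 0 <= g x <= 1.
  rewrite /g divr_ge0 ?subr_ge0 ?(ltW c0)//= ler_pdivrMr// mul1r.
  by rewrite lerBlDr addrC.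
have mg : measurable_fun setT g.
  by apply: measurable_funM => //; apply: measurable_funB.
have ig : m.-integrable setT (EFin \o g).
  apply: (@integrable_of_bounded _ 1) => // x.
  by have /andP[g0 g1] := g01 x; rewrite ger0_norm.
have if_ : m.-integrable setT (EFin \o f) by exact: integrable_of_bounded fB.
pose p := \int[m]_x g x.
have p01 : 0 <= p <= 1.
  apply/andP; split; first by apply: Rintegral_ge0 => x _; have /andP[] := g01 x.
  rewrite -[leRHS]Rintegral_prob_cst; apply: le_Rintegral => //.
    by apply: (@integrable_of_bounded _ 1) => // x; rewrite normr1.
  by move=> x _; have /andP[] := g01 x.
have fE x : f x = a + c * g x.
  by rewrite /g mulrCA mulfV ?gt_eqF// mulr1 addrC subrK.
have pE : \int[m]_x f x = a + c * p.
  under eq_Rintegral do rewrite fE.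
  rewrite RintegralD//; last 2 first.
  - by apply: (@integrable_of_bounded _ `|a|).
  - apply: (@integrable_of_bounded _ c); first exact: measurable_funM.
    move=> x; have /andP[g0 g1] := g01 x.
    by rewrite normrM !ger0_norm ?(ltW c0)// ler_piMr// ltW.
  by rewrite Rintegral_prob_cst RintegralZl.
have chord x : expR (l * f x) <= expR (l * a) * ((1 - g x) + g x * expR (l * c)).
  rewrite fE mulrDr expRD ler_wpM2l ?expR_ge0// mulrA.
  by rewrite (le_trans (expR_le_chord _ (g01 x))).
have mE : measurable_fun setT (fun x => expR (l * f x)).
  by apply: measurableT_comp => //; apply: measurable_funM.
apply: (@le_trans _ _ (expR (l * a) * ((1 - p) + p * expR (l * c)))); last first.
  rewrite pE (mulrDr l) -[in leRHS]addrA expRD ler_wpM2l ?expR_ge0//.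
  rewrite (le_trans (two_point_mgf_le p01 _)) ?mulr_ge0 ?(ltW c0)//.
  by have -> : p * (l * c) = l * (c * p) by ring.
have i1 : m.-integrable setT (EFin \o (fun x => 1 - g x)).
  apply: (@integrable_of_bounded _ 1); first exact: measurable_funB.
  by move=> x; have /andP[g0 g1] := g01 x; rewrite ger0_norm ?subr_ge0// lerBlDr lerDl.
have i2 : m.-integrable setT (EFin \o (fun x => g x * expR (l * c))).
  apply: (@integrable_of_bounded _ (expR (l * c))); first exact: measurable_funM.
  move=> x; have /andP[g0 g1] := g01 x.
  by rewrite normrM !ger0_norm ?expR_ge0// ler_piMl// expR_ge0.
have i3 : m.-integrable setT (EFin \o (fun x => 1 - g x + g x * expR (l * c))).
  exact: (integrableD measurableT i1 i2).
have -> : expR (l * a) * ((1 - p) + p * expR (l * c)) =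
    \int[m]_x (expR (l * a) * ((1 - g x) + g x * expR (l * c))).
  rewrite RintegralZl// RintegralD// RintegralZr// RintegralB//.
    by rewrite Rintegral_prob_cst.
  by apply: (@integrable_of_bounded _ 1) => // x; rewrite normr1.
apply: le_Rintegral => //.
  apply: (@integrable_of_bounded _ (expR (l * (a + c)))) => // x.
  by rewrite ger0_norm ?expR_ge0// ler_expR ler_wpM2l.
exact: (integrableZl measurableT _ i3).
Qed.

End hoeffding.

(** * Coordinate-Lipschitz functions of a trajectory *)

Section coordinate_lipschitz.
Context {d : measure_display} {R : realType} {T : polishType d R}.
Implicit Types (a : nat -> R) (F G : (nat -> T) -> R).

Lemma dense_sequence :
  exists q : nat -> T, forall x (e : R), 0 < e -> exists j, mdist x (q j) < e.
Proof.
have [D /countable_injP[f fI] dD] := @polish_separable d R T.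
exists (fun j => xget point [set x | D x /\ f x = j]) => x e e0.
have xe : (ball x e)^° !=set0 by exists x; exact: nbhsx_ballx.
have [z [/= xz Dz]] := dD _ xe (@open_interior _ _).
exists (f z); case: xgetP => [y _ [Dy fyz]|/(_ z)/not_andP[]//].
have -> : y = z by apply: fI; rewrite ?inE.
by have := interior_subset xz; rewrite ballEmdist.
Qed.

(** The sequences through which a dense sequence [q] approximates any finite
    number of coordinates: they are indexed by the codes of finite lists. *)
Definition sample (q : nat -> T) (m : nat) : nat -> T :=
  fun i => q (nth 0 (CodeSeq.decode m) i).

Lemma sample_dense (q : nat -> T) :
  (forall x (e : R), 0 < e -> exists j, mdist x (q j) < e) ->
  forall (k : nat) (x : nat -> T) (e : R), 0 < e ->
  exists m, forall i, (i < k)%N -> mdist (x i) (sample q m i) < e.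
Proof.
move=> qD k x e e0.
have [j jP] := choice (fun i => qD (x i) e e0).
exists (CodeSeq.code (mkseq j k)) => i ik.
by rewrite /sample CodeSeq.codeK nth_mkseq.
Qed.

(** As the distance is finite, this also says that [F] depends on its
    first [k] coordinates only. *)
Definition coord_lip (k : nat) a F :=
  forall x y : nat -> T, `|F x - F y| <= \sum_(i < k) a i * mdist (x i) (y i).

Lemma measurable_mdist1 (z : T) : measurable_fun setT (fun x => mdist z x : R).
Proof.
apply: (measurability _ (RGenInftyO.measurableE R)) => _ [_ [r ->] <-].
rewrite setTI polish_borel; apply: sub_sigma_algebra => /=.
rewrite openE => x /=; rewrite in_itv/= => xr.
apply/nbhs_ballP; exists (r - mdist z x); first by rewrite /= subr_gt0.
move=> y; rewrite ballEmdist/= in_itv/= => xy.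
by rewrite (le_lt_trans (metric_triangle z x y))// -ltrBrDl.
Qed.

(** The set where [F > r] is the countable union, over the sampled sequences
    [q_m], of the sets where the lower estimate [F q_m - D_m] exceeds [r],
    and the weighted distance [D_m] to [q_m] is measurable.  No measurable
    structure on the product of the coordinates is involved. *)
Lemma measurable_coord_lip (k : nat) a F d' (O : measurableType d')
    (Z : nat -> O -> T) :
  (forall i, 0 <= a i) -> coord_lip k a F ->
  (forall i, (i < k)%N -> measurable_fun setT (Z i)) ->
  measurable_fun setT (fun w => F (Z ^~ w)).
Proof.
move=> a0 FL mZ; have [q /sample_dense qD] := dense_sequence.
pose D m w : R := \sum_(i < k) a i * mdist (sample q m i) (Z i w).
have mD m : measurable_fun setT (D m).
  apply: measurable_sum => i; apply: measurable_funM => //.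
  exact: (measurableT_comp (measurable_mdist1 _) (mZ i (ltn_ord i))).
have D_FL m w : `|F (sample q m) - F (Z ^~ w)| <= D m w by exact: FL.
apply: (measurability _ (RGenOInfty.measurableE R)) => _ [_ [r ->] <-].
rewrite setTI.
rewrite (_ : _ @^-1` _ =
  \bigcup_m (fun w => F (sample q m) - D m w) @^-1` `]r, +oo[).
  apply: bigcup_measurable => m _; rewrite -[X in measurable X]setTI.
  by apply: measurable_funB => //; exact: measurable_itv.
apply/seteqP; split => w /=; rewrite in_itv/= andbT.
  (* [F q_m - D_m] is at least [F - 2 D_m], so [q_m] is taken with
     [2 D_m < F - r]; the summand 1 only avoids dividing by 0 *)
  move=> rF; pose e := (F (Z ^~ w) - r) / (2 * (\sum_(i < k) a i) + 1).
  have A0 : 0 <= \sum_(i < k) a i by apply: sumr_ge0.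
  have e0 : 0 < e by rewrite divr_gt0 ?subr_gt0// ltr_wpDl ?mulr_ge0.
  have [m mP] := qD k (Z ^~ w) e e0.
  exists m => //=; rewrite in_itv/= andbT.
  have Dle : D m w <= e * \sum_(i < k) a i.
    rewrite mulr_sumr; apply: ler_sum => i _.
    by rewrite mulrC ler_wpM2r// metric_sym ltW// mP.
  have eE : e * (2 * (\sum_(i < k) a i) + 1) = F (Z ^~ w) - r.
    by rewrite /e divfK// gt_eqF// ltr_wpDl ?mulr_ge0.
  have := D_FL m w; rewrite ler_norml => /andP[h _].
  by move: Dle eE h; rewrite mulrDr mulr1 mulrCA; lra.
move=> [m _ /=]; rewrite in_itv/= andbT => rF.
by have := D_FL m w; rewrite ler_norml => /andP[_ h]; lra.
Qed.

Lemma measurable_mdist2 :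
  measurable_fun setT (fun z : T * T => mdist z.1 z.2 : R).
Proof.
pose Z (i : nat) (z : T * T) : T := if i is 0 then z.1 else z.2.
have FL : coord_lip 2 (fun=> 1) (fun x : nat -> T => mdist (x 0) (x 1)).
  move=> x y; rewrite big_ord_recl big_ord1 !mul1r/= ler_norml.
  have h1 := metric_triangle (x 0) (y 0) (x 1).
  have h2 := metric_triangle (y 0) (y 1) (x 1).
  have h3 := metric_triangle (y 0) (x 0) (y 1).
  have h4 := metric_triangle (x 0) (x 1) (y 1).
  move: h1 h2 h3 h4; rewrite (metric_sym (y 0) (x 0)) (metric_sym (y 1) (x 1)).
  by rewrite /bump/=; lra.
apply: (@measurable_coord_lip _ _ _ _ _ Z _ FL) => //.
by move=> [|[|//]] _; [exact: measurable_fst|exact: measurable_snd].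
Qed.

Lemma measurable_lipschitz (f : T -> R) (L : R) :
  0 <= L -> (forall x y, `|f x - f y| <= L * mdist x y) ->
  measurable_fun setT f.
Proof.
move=> L0 fL.
have FL : coord_lip 1 (fun=> L) (fun x : nat -> T => f (x 0)).
  by move=> x y; rewrite big_ord1.
exact: (@measurable_coord_lip _ _ _ _ _ (fun=> id) _ FL).
Qed.

End coordinate_lipschitz.

(** * Wasserstein contraction *)

Section transport.
Context {d : measure_display} {R : realType} {T : polishType d R}.
Hypothesis dist_le1 : forall x y : T, mdist x y <= 1.

Lemma lip_bounded (g : T -> R) (L : R) : 0 <= L ->
  (forall x y, `|g x - g y| <= L * mdist x y) ->
  forall x, `|g x| <= `|g point| + L.
Proof.
move=> L0 gL; apply: bounded_of_oscillation => x y.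
rewrite (le_trans (ler_norm _))// (le_trans (gL x y))// -[leRHS]mulr1.
exact: ler_wpM2l.
Qed.

Lemma Rintegral_pushforward_eq d' (O : measurableType d') (pi : {measure set O -> \bar R})
    (nu : {measure set T -> \bar R}) (h : O -> T) (g : T -> R) (M : R) :
  pi setT = 1%E -> measurable_fun setT h -> measurable_fun setT g ->
  (forall x, `|g x| <= M) ->
  (forall A, measurable A -> nu A = pi (h @^-1` A)) ->
  \int[nu]_x g x = \int[pi]_w g (h w).
Proof.
move=> pi1 mh mg gM nuE; congr fine.
rewrite (eq_measure_integral (pushforward pi h)); last by move=> A mA _; exact: nuE.
have := @integral_pushforward _ _ _ _ _ h mh pi setT (EFin \o g).
rewrite preimage_setT; apply => //; first exact/measurable_EFinP.
apply: (@integrable_of_bounded _ _ _ pi pi1 (g \o h) M).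
  exact: measurableT_comp.
by move=> w; exact: gM.
Qed.

(** The easy half of Kantorovich duality: under any coupling, the difference
    of the two means is the mean of [g z.1 - g z.2]. *)
Lemma Rintegral_sub_le_W1 (mu nu : {measure set T -> \bar R}) (g : T -> R)
    (L r : R) :
  mu setT = 1%E -> nu setT = 1%E -> 0 < L ->
  (forall x y, `|g x - g y| <= L * mdist x y) ->
  (W1 mu nu <= r%:E)%E ->
  \int[mu]_x g x - \int[nu]_x g x <= L * r.
Proof.
move=> mu1 nu1 L0 gL W1r.
have mg : measurable_fun setT g by apply: measurable_lipschitz gL; exact: ltW.
have gM := lip_bounded (ltW L0) gL.
rewrite mulrC -ler_pdivrMr// -lee_fin (le_trans _ W1r)//.
apply: le_ereal_inf_tmp => _ [pi [pi_mu pi_nu] <-].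
have pi1 : pi setT = 1%E by exact: probability_setT.
have m1 : measurable_fun setT (fun z : T * T => g z.1).
  by apply: (measurableT_comp mg); exact: measurable_fst.
have m2 : measurable_fun setT (fun z : T * T => g z.2).
  by apply: (measurableT_comp mg); exact: measurable_snd.
have E1 : \int[mu]_x g x = \int[pi]_z g z.1.
  apply: (Rintegral_pushforward_eq pi1 _ mg gM); first exact: measurable_fst.
  by move=> A mA; rewrite -pi_mu// -setXT.
have E2 : \int[nu]_x g x = \int[pi]_z g z.2.
  apply: (Rintegral_pushforward_eq pi1 _ mg gM); first exact: measurable_snd.
  by move=> A mA; rewrite -pi_nu// -setTX.
have i1 : pi.-integrable setT (EFin \o (fun z : T * T => g z.1)).
  by apply: (integrable_of_bounded pi1 m1) => z; exact: gM.
have i2 : pi.-integrable setT (EFin \o (fun z : T * T => g z.2)).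
  by apply: (integrable_of_bounded pi1 m2) => z; exact: gM.
have id : pi.-integrable setT (EFin \o (fun z : T * T => mdist z.1 z.2)).
  apply: (integrable_of_bounded pi1 measurable_mdist2) => z.
  by rewrite ger0_norm ?mdist_ge0.
rewrite E1 E2 -RintegralB//.
rewrite (_ : (\int[pi]_z (mdist z.1 z.2)%:E)%E = (\int[pi]_z mdist z.1 z.2)%:E);
  last by rewrite fineK//; exact: integrable_fin_num.
rewrite lee_fin ler_pdivrMr// mulrC -RintegralZl//.
apply: le_Rintegral => //.
- exact: (integrableB measurableT i1 i2).
- exact: (integrableZl measurableT _ id).
- by move=> z _; rewrite (le_trans (ler_norm _)).
Qed.

End transport.

Section next_mean.
Context {d : measure_display} {R : realType} {T : polishType d R}.
Hypothesis dist_le1 : forall x y : T, mdist x y <= 1.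
Implicit Types (a : nat -> R) (F G : (nat -> T) -> R).

Definition upd (x : nat -> T) (k : nat) (y : T) : nat -> T :=
  fun i => if i == k then y else x i.

Lemma coord_lip_upd (k : nat) a F x (y y' : T) : coord_lip k.+1 a F ->
  `|F (upd x k y) - F (upd x k y')| <= a k * mdist y y'.
Proof.
move=> /(_ (upd x k y) (upd x k y')); rewrite big_ord_recr/= /upd eqxx.
rewrite big1 ?add0r// => i _.
by rewrite (ltn_eqF (ltn_ord i)) mdistxx mulr0.
Qed.

Lemma measurable_coord_lip_upd (k : nat) a F x : 0 <= a k -> coord_lip k.+1 a F ->
  measurable_fun setT (fun y => F (upd x k y)).
Proof.
move=> a0 FL; apply: (measurable_lipschitz a0) => y y'.
exact: coord_lip_upd FL.
Qed.

Lemma coord_lip_oscillation (k : nat) a F : (forall i, 0 <= a i) ->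
  coord_lip k a F -> forall x y, F x - F y <= \sum_(i < k) a i.
Proof.
move=> a0 FL x y; rewrite (le_trans (ler_norm _))// (le_trans (FL x y))//.
by apply: ler_sum => i _; rewrite -[leRHS]mulr1 ler_wpM2l.
Qed.

Lemma coord_lip_bounded (k : nat) a F : (forall i, 0 <= a i) ->
  coord_lip k a F -> exists M, forall x, `|F x| <= M.
Proof.
move=> a0 /(coord_lip_oscillation a0) FM.
exists (`|F (fun=> point)| + \sum_(i < k) a i) => x.
have -> : F x = F (fun=> point) + (F x - F (fun=> point)) by rewrite addrC subrK.
by rewrite (le_trans (ler_normD _ _))// lerD2l ler_norml FM lerNl opprB FM.
Qed.

Variables (P : R.-pker T ~> T) (kappa : R).
Hypothesis contraction :
  forall x y : T, (W1 (P x) (P y) <= (kappa * mdist x y)%:E)%E.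

Definition next_mean (k : nat) F x : R := \int[P (x k)]_y F (upd x k.+1 y).

(** Moving from [x] to [z] changes the integrand, which accounts for the
    weights [a i] with [i <= k], and then the law of the new point from
    [P (x k)] to [P (z k)], which costs [kappa * a k.+1] by duality. *)
Lemma next_mean_lip (k : nat) a F : (forall i, 0 < a i) ->
  coord_lip k.+2 a F ->
  coord_lip k.+1 (fun i => if i == k then a k + kappa * a k.+1 else a i)
    (next_mean k F).
Proof.
move=> a0 FL.
have a0' i : 0 <= a i by exact: ltW.
have [M FM] := coord_lip_bounded a0' FL.
have iF (x z : nat -> T) : (P (x k)).-integrable setT
    (EFin \o (fun y => F (upd z k.+1 y))).
  apply: (@integrable_of_bounded _ _ _ _ _ _ M) => //; first exact: prob_kernel.
  exact: measurable_coord_lip_upd FL.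
suff le x z : next_mean k F x - next_mean k F z <=
    \sum_(i < k.+1) (if i == k :> nat then a k + kappa * a k.+1 else a i)
      * mdist (x i) (z i).
  move=> x z; rewrite ler_norml le andbT lerNl opprB.
  under eq_bigr do rewrite metric_sym.
  exact: le.
rewrite /next_mean big_ord_recr/= eqxx.
under eq_bigr => i _ do rewrite (ltn_eqF (ltn_ord i)).
rewrite -(subrK (\int[P (x k)]_y F (upd z k.+1 y))
  (\int[P (x k)]_y F (upd x k.+1 y))) -addrA mulrDl [leRHS]addrA lerD//; last first.
  rewrite [leRHS](_ : _ = a k.+1 * (kappa * mdist (x k) (z k))); last by ring.
  apply: Rintegral_sub_le_W1 => //; [exact: prob_kernel|exact: prob_kernel|].
  by move=> y y'; exact: coord_lip_upd FL.
rewrite -RintegralB//.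
set s := leRHS.
rewrite -[s](@Rintegral_prob_cst _ _ _ (P (x k))) ?prob_kernel//.
apply: le_Rintegral => //.
- exact: (integrableB measurableT (iF x x) (iF x z)).
- apply: (@integrable_of_bounded _ _ _ _ _ _ `|s|) => //; exact: prob_kernel.
move=> y _; rewrite (le_trans (ler_norm _))// (le_trans (FL _ _))//.
rewrite !big_ord_recr/= /upd eqxx mdistxx mulr0 addr0 (ltn_eqF (ltnSn k)).
rewrite /s lerD2r; apply: ler_sum => i _.
by rewrite (ltn_eqF (ltn_trans (ltn_ord i) (ltnSn k))).
Qed.

End next_mean.

(** * Integrating out one step of the chain *)

Section kernel_swap.
Context d d' (O : measurableType d) (T : measurableType d') (R : realType).
Variables (m : {measure set O -> \bar R}) (H : set O).
Hypothesis mH : measurable H.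
Local Open Scope ereal_scope.

Let measurable_family (K : O -> {measure set T -> \bar R}) :=
  forall A, measurable A -> measurable_fun setT (K ^~ A).

Import HBNNSimple.

Lemma integral_kernel_nnsfun (K : O -> {measure set T -> \bar R})
    (f : {nnsfun T >-> R}) : measurable_family K ->
  \int[m]_(w in H) \int[K w]_y (f y)%:E =
  \sum_(r \in range f) r%:E * \int[m]_(w in H) K w (f @^-1` [set r]).
Proof.
move=> mK; have mK' r : measurable_fun H (fun w => K w (f @^-1` [set r])).
  by apply: measurable_funTS; exact: mK.
under eq_integral do rewrite integralT_nnsfun sintegralE.
rewrite ge0_integral_fsum//; last 2 first.
- by move=> r; exact: measurable_funeM.
- by move=> r w _; exact: nnsfun_mulemu_ge0.
apply: eq_fsbigr => r _.
have [r0|r0] := leP 0%R r; first by rewrite ge0_integralZl.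
rewrite preimage_nnfun0//.
rewrite [LHS]integral0_eq; last by move=> w _; rewrite measure0 mule0.
by rewrite integral0_eq ?mule0// => w _; rewrite measure0.
Qed.

Lemma integral_kernel_lim (K : O -> {measure set T -> \bar R}) (h : T -> \bar R)
    (mh : measurable_fun setT h) :
  measurable_family K -> (forall y, 0 <= h y) ->
  \int[m]_(w in H) \int[K w]_y h y =
  limn (fun n => \int[m]_(w in H) \int[K w]_y (nnsfun_approx measurableT mh n y)%:E).
Proof.
move=> mK h0; pose f := nnsfun_approx measurableT mh.
rewrite -monotone_convergence//; last 3 first.
- move=> n; apply: measurable_funTS; apply: measurable_fun_integral_kernel => //.
  + by move=> y; rewrite lee_fin.
  + exact/measurable_EFinP.
- by move=> n w _; apply: integral_ge0 => y _; rewrite lee_fin.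
- move=> w _ a b ab; apply: ge0_le_integral => //.
  + by move=> y _; rewrite lee_fin.
  + exact/measurable_EFinP.
  + exact/measurable_EFinP.
  + by move=> y _; rewrite lee_fin; exact/lefP/nd_nnsfun_approx.
apply: eq_integral => w _; rewrite -monotone_convergence//; last 3 first.
- by move=> n; exact/measurable_EFinP.
- by move=> n y _; rewrite lee_fin.
- by move=> y _ a b ab; rewrite lee_fin; exact/lefP/nd_nnsfun_approx.
by apply: eq_integral => y _; apply/esym/cvg_lim => //; exact: cvg_nnsfun_approx.
Qed.

(** Equality of the two mixtures of kernels on measurable sets extends to
    nonnegative functions by approximation with simple functions.  It turns
    the definition of a Markov chain, which is about sets, into
    [markov_chain_integral]. *)
Lemma eq_integral_kernel (K1 K2 : O -> {measure set T -> \bar R})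
    (h : T -> \bar R) : measurable_family K1 -> measurable_family K2 ->
  (forall A, measurable A ->
     \int[m]_(w in H) K1 w A = \int[m]_(w in H) K2 w A) ->
  measurable_fun setT h -> (forall y, 0 <= h y) ->
  \int[m]_(w in H) \int[K1 w]_y h y = \int[m]_(w in H) \int[K2 w]_y h y.
Proof.
move=> mK1 mK2 K12 mh h0; rewrite !(integral_kernel_lim mh)//.
congr (limn _); apply/funext => n.
by rewrite !integral_kernel_nnsfun//; apply: eq_fsbigr => r _; rewrite K12.
Qed.

End kernel_swap.

Section markov_step.
Context {d : measure_display} {T : measurableType d} {R : realType}.
Context {d' : measure_display} {O : measurableType d'} {Pr : probability O R}.
Variables (P : R.-pker T ~> T) (X : nat -> {RV Pr >-> T}).
Hypothesis chainX : markov_chain P X.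
Local Open Scope ereal_scope.

Lemma past_measurable n (H : set O) : past (fun i => X i : O -> T) n H -> measurable H.
Proof.
apply: smallest_sub => //; first exact: sigma_algebra_measurable.
move=> _ [i _ [A mA <-]]; rewrite setTI.
by rewrite -[X in measurable X]setTI; exact: measurable_funPT.
Qed.

Lemma markov_chain_integral n (H : set O) (h : T -> \bar R) :
  past (fun i => X i : O -> T) n H -> measurable_fun setT h -> (forall y, 0 <= h y) ->
  \int[Pr]_(w in H) h (X n.+1 w) = \int[Pr]_(w in H) \int[P (X n w)]_y h y.
Proof.
move=> pH mh h0; have mH := past_measurable pH.
have mX i : measurable_fun setT (X i : O -> T) by exact: measurable_funPT.
(* evaluation at [X n.+1 w] is integration against a Dirac kernel *)
rewrite -(@eq_integral_kernel _ _ _ _ _ _ _ mH (fun w => \d_(X n.+1 w)))//.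
- by apply: eq_integral => w _; rewrite integral_dirac// diracT mul1e.
- by move=> A mA; apply: (measurableT_comp (measurable_fun_dirac mA)).
- by move=> A mA; exact: (measurableT_comp (measurable_kernel P _ mA)).
- move=> A mA; rewrite -chainX//.
  rewrite setIC -integral_indic//.
  by rewrite -[X in measurable X]setTI; exact: mX.
Qed.

End markov_step.

Section disintegration.
Context {d : measure_display} {R : realType} {T : polishType d R}.
Hypothesis dist_le1 : forall x y : T, mdist x y <= 1.
Variables (P : R.-pker T ~> T) (kappa : R).
Hypothesis kappa_ge0 : 0 <= kappa.
Hypothesis contraction :
  forall x y : T, (W1 (P x) (P y) <= (kappa * mdist x y)%:E)%E.
Context {d' : measure_display} {O : measurableType d'} {Pr : probability O R}.
Variable X : nat -> {RV Pr >-> T}.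
Hypothesis chainX : markov_chain P X.
Implicit Types (a : nat -> R) (F G : (nat -> T) -> R).

Let path w : nat -> T := X ^~ w.

Let mX i : measurable_fun setT (X i : O -> T).
Proof. exact: measurable_funPT. Qed.

Let Pr1 : Pr setT = 1%E. Proof. exact: probability_setT. Qed.

Lemma measurable_path (k : nat) a F : (forall i, 0 <= a i) -> coord_lip k a F ->
  measurable_fun setT (fun w => F (path w)).
Proof. by move=> a0 FL; apply: (measurable_coord_lip a0 FL) => i _. Qed.

Lemma integrable_path (k : nat) a F : (forall i, 0 <= a i) -> coord_lip k a F ->
  Pr.-integrable setT (EFin \o (fun w => F (path w))).
Proof.
move=> a0 FL; have [M FM] := coord_lip_bounded dist_le1 a0 FL.
by apply: (integrable_of_bounded Pr1 (measurable_path a0 FL)) => w; exact: FM.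
Qed.

Lemma integrable_upd (k : nat) a F (x z : nat -> T) i : (forall i, 0 <= a i) ->
  coord_lip k.+1 a F ->
  (P (z i)).-integrable setT (EFin \o (fun y => F (upd x k y))).
Proof.
move=> a0 FL; have [M FM] := coord_lip_bounded dist_le1 a0 FL.
apply: (@integrable_of_bounded _ _ _ _ _ _ M); first exact: prob_kernel.
  exact: measurable_coord_lip_upd FL.
by move=> y; exact: FM.
Qed.

(** Discretization of the past: the events that a given sampled sequence is
    [e]-close to the path only involve the first [k.+1] coordinates and cover
    everything by density; they are then made disjoint. *)
Lemma past_cells (k : nat) a (e : R) : (forall i, 0 <= a i) -> 0 < e ->
  exists (H : (set O)^nat) (q : nat -> nat -> T),
    [/\ forall j, past (fun i => X i : O -> T) k (H j), trivIset setT H,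
        \bigcup_j H j = setT &
        forall j w, H j w -> \sum_(i < k.+1) a i * mdist (path w i) (q j i) <= e].
Proof.
move=> a0 e0; have [q /sample_dense qD] := @dense_sequence d R T.
pose G := \bigcup_(i in `I_k.+1)
  preimage_set_system [set: O] (X i : O -> T) measurable.
(* the sample space with the sigma-algebra of the past *)
pose O' : measurableType _ := g_sigma_algebraType G.
have mX' i : (i < k.+1)%N -> measurable_fun setT (X i : O' -> T).
  move=> ik _ A mA; apply: sub_sigma_algebra.
  by exists i => //; exists A.
pose D j w : R := \sum_(i < k.+1) a i * mdist (sample q j i) (path w i).
have mD j : measurable_fun setT (D j : O' -> R).
  apply: measurable_sum => i; apply: measurable_funM => //.
  exact: (measurableT_comp (measurable_mdist1 _) (mX' i (ltn_ord i))).
pose C j : set O' := D j @^-1` `]-oo, e].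
have mC j : measurable (C j).
  by rewrite -[C j]setTI; apply: mD => //; exact: measurable_itv.
exists (seqDU C), (sample q); split.
- by move=> j; have := seqDU_measurable mC j.
- exact: trivIset_seqDU.
- rewrite -seqDU_bigcup_eq; apply/seteqP; split => // w _.
  pose A := \sum_(i < k.+1) a i.
  have A0 : 0 <= A by exact: sumr_ge0.
  have [|j jP] := qD k.+1 (path w) (e / (A + 1)).
    by rewrite divr_gt0// ltr_wpDl.
  exists j => //; rewrite /C/= in_itv/=.
  have : D j w <= e / (A + 1) * A.
    rewrite mulr_sumr; apply: ler_sum => i _.
    by rewrite mulrC ler_wpM2r// metric_sym ltW// jP.
  move=> Dle; rewrite (le_trans Dle)// -mulrA ler_piMr ?(ltW e0)//.
  by rewrite mulrC ler_pdivrMr ?ltr_wpDl// mul1r lerDl.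
- move=> j w Hw; have := subset_seqDU Hw; rewrite /C/= in_itv/=.
  by under eq_bigr do rewrite metric_sym.
Qed.

(** On a cell of the past [G (path w)] is within [e] of a function of the new
    point alone, to which the Markov property over that cell applies; going
    back to [G] costs another [e]. *)
Lemma disintegration_ge0_le (k : nat) a G (e : R) : (forall i, 0 < a i) ->
  coord_lip k.+2 a G -> (forall x, 0 <= G x) -> 0 < e ->
  (\int[Pr]_w (G (path w))%:E <=
   \int[Pr]_w (next_mean P k G (path w) + (e + e))%:E)%E.
Proof.
move=> a0 GL G0 e0.
have a0' i : 0 <= a i by exact: ltW.
have AL := next_mean_lip dist_le1 contraction a0 GL.
have b0 i : 0 <= if i == k then a k + kappa * a k.+1 else a i.
  by case: ifP => // _; rewrite addr_ge0// mulr_ge0.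
have mG := measurable_path a0' GL.
have mA := measurable_path b0 AL.
have A0 x : 0 <= next_mean P k G x by apply: Rintegral_ge0.
have [H [q [pH tH HT Hq]]] := @past_cells k a e a0' e0.
have mH j := past_measurable (pH j).
rewrite -HT ge0_integral_bigcup//; last 2 first.
- by apply/measurable_EFinP; rewrite HT.
- by move=> w _; rewrite lee_fin.
rewrite ge0_integral_bigcup//; last 2 first.
- by apply/measurable_EFinP; rewrite HT; exact: measurable_funD.
- by move=> w _; rewrite lee_fin !addr_ge0 ?(ltW e0).
apply: lee_nneseries => [j _ _|j _].
  by apply: integral_ge0 => w _; rewrite lee_fin.
pose g y := G (upd (q j) k.+1 y).
have mg : measurable_fun setT g by exact: measurable_coord_lip_upd GL.
have g0 y : 0 <= g y by exact: G0.
have close w y : H j w -> `|G (upd (path w) k.+1 y) - g y| <= e.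
  move=> /Hq; apply: le_trans; rewrite (le_trans (GL _ _))//.
  rewrite big_ord_recr/= /upd eqxx mdistxx mulr0 addr0.
  by apply: ler_sum => i _; rewrite (ltn_eqF (ltn_ord i)).
have pathE w : upd (path w) k.+1 (X k.+1 w) = path w.
  by apply/funext => i; rewrite /upd; case: eqP => // ->.
have mgX : measurable_fun (H j) (fun w => (g (X k.+1 w))%:E).
  apply/measurable_EFinP; apply: measurable_funTS.
  exact: (measurableT_comp mg (mX k.+1)).
have e_ge0 := ltW e0.
apply: (@le_trans _ _ (\int[Pr]_(w in H j) ((g (X k.+1 w))%:E + e%:E))%E).
  apply: ge0_le_integral => //.
  - by move=> w _; rewrite lee_fin.
  - by apply/measurable_EFinP; apply: measurable_funTS.
  - by apply: emeasurable_funD.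
  - by move=> w Hw; rewrite -EFinD lee_fin -(pathE w) -lerBlDl
      (le_trans (ler_norm _))// pathE -{1}(pathE w) close.
have mPg : measurable_fun (H j) (fun w => \int[P (X k w)]_y (g y)%:E)%E.
  apply: measurable_funTS.
  apply: (@measurable_fun_integral_kernel _ _ _ _ _ (fun w => P (X k w))).
  - by move=> U mU; exact: (measurableT_comp (measurable_kernel P _ mU)).
  - by move=> y; rewrite lee_fin.
  - exact/measurable_EFinP.
rewrite ge0_integralD//; last by move=> w _; rewrite lee_fin.
rewrite (@markov_chain_integral _ _ _ _ _ _ _ _ chainX _ _ (EFin \o g) (pH j))//;
  last exact/measurable_EFinP.
rewrite -ge0_integralD//; last first.
  by move=> w _; apply: integral_ge0 => y _; rewrite lee_fin.
apply: ge0_le_integral => //.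
- move=> w _; rewrite adde_ge0 ?lee_fin//.
  by apply: integral_ge0 => y _; rewrite lee_fin.
- by apply: emeasurable_funD.
- by apply/measurable_EFinP; apply: measurable_funTS; exact: measurable_funD.
move=> w Hw.
have ig := @integrable_upd _ _ _ (q j) (path w) k a0' GL.
have iG := @integrable_upd _ _ _ (path w) (path w) k a0' GL.
have -> : (\int[P (X k w)]_y (g y)%:E = (\int[P (X k w)]_y g y)%:E)%E.
  by rewrite fineK//; exact: integrable_fin_num ig.
rewrite -EFinD lee_fin addrA lerD2r.
rewrite -lerBlDl -RintegralB//.
rewrite -[leRHS](@Rintegral_prob_cst _ _ _ (P (X k w))) ?prob_kernel//.
apply: le_Rintegral => //.
- exact: (integrableB measurableT ig iG).
- by apply: (@integrable_of_bounded _ _ _ _ _ _ `|e|) => //; exact: prob_kernel.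
by move=> y _; rewrite (le_trans (ler_norm _))// distrC close.
Qed.

(** Adding an upper bound [M] of [|G|] reduces to the nonnegative case. *)
Lemma disintegration_le (k : nat) a G : (forall i, 0 < a i) ->
  coord_lip k.+2 a G ->
  \int[Pr]_w G (path w) <= \int[Pr]_w next_mean P k G (path w).
Proof.
move=> a0 GL.
have a0' i : 0 <= a i by exact: ltW.
have AL := next_mean_lip dist_le1 contraction a0 GL.
have b0 i : 0 <= if i == k then a k + kappa * a k.+1 else a i.
  by case: ifP => // _; rewrite addr_ge0// mulr_ge0.
have [M GM] := coord_lip_bounded dist_le1 a0' GL.
have cst_int c : Pr.-integrable setT (EFin \o (fun _ : O => c)).
  by apply: (@integrable_of_bounded _ _ _ _ Pr1 _ `|c|).
have iG := integrable_path a0' GL.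
have iA := integrable_path b0 AL.
apply/ler_addgt0Pr => e e0.
have GML : coord_lip k.+2 a (fun x => G x + M).
  by move=> x y; rewrite opprD addrACA subrr addr0; exact: GL.
have GM0 x : 0 <= G x + M by have := GM x; rewrite ler_norml -lerBlDr sub0r => /andP[].
have AM x : next_mean P k (fun x => G x + M) x = next_mean P k G x + M.
  rewrite /next_mean RintegralD//; last 2 first.
  - exact: integrable_upd a0' GL.
  - by apply: (@integrable_of_bounded _ _ _ _ _ _ `|M|) => //; exact: prob_kernel.
  by rewrite Rintegral_prob_cst//; exact: prob_kernel.
have iGM := integrableD measurableT iG (cst_int M).
have iAMe := integrableD measurableT iA (cst_int (M + e)).
have : \int[Pr]_w (G (path w) + M) <= \int[Pr]_w (next_mean P k G (path w) + (M + e)).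
  apply: fine_le; [exact: integrable_fin_num iGM|exact: integrable_fin_num iAMe|].
  have e2 : 0 < e / 2 by rewrite divr_gt0.
  have := @disintegration_ge0_le k a _ (e / 2) a0 GML GM0 e2.
  by under [leRHS]eq_integral do rewrite AM -splitr -addrA.
rewrite !RintegralD// !Rintegral_prob_cst//.
by rewrite addrA addrAC lerD2r.
Qed.

(** The tower property; the reverse inequality is the direct one for [- G]. *)
Lemma disintegration (k : nat) a G : (forall i, 0 < a i) ->
  coord_lip k.+2 a G ->
  \int[Pr]_w G (path w) = \int[Pr]_w next_mean P k G (path w).
Proof.
move=> a0 GL; apply/eqP; rewrite eq_le (disintegration_le a0 GL)/=.
have a0' i : 0 <= a i by exact: ltW.
have AL := next_mean_lip dist_le1 contraction a0 GL.
have b0 i : 0 <= if i == k then a k + kappa * a k.+1 else a i.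
  by case: ifP => // _; rewrite addr_ge0// mulr_ge0.
have NL : coord_lip k.+2 a (fun x => - 1 * G x).
  by move=> x y; rewrite -mulrBr normrM normrN1 mul1r; exact: GL.
have := disintegration_le a0 NL.
have NE x : next_mean P k (fun x => - 1 * G x) x = - 1 * next_mean P k G x.
  by rewrite /next_mean RintegralZl//; exact: integrable_upd a0' GL.
under [leRHS]eq_Rintegral do rewrite NE.
rewrite !RintegralZl//; last 2 first.
- exact: integrable_path b0 AL.
- exact: integrable_path a0' GL.
by rewrite !mulN1r lerN2.
Qed.

End disintegration.

(** * Concentration for contracting Markov chains *)

Section concentration.
Context {d : measure_display} {R : realType} {T : polishType d R}.
Hypothesis dist_le1 : forall x y : T, mdist x y <= 1.
Variables (P : R.-pker T ~> T) (kappa : R).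
Hypothesis kappa_ge0 : 0 <= kappa.
Hypothesis contraction :
  forall x y : T, (W1 (P x) (P y) <= (kappa * mdist x y)%:E)%E.
Implicit Types (a : nat -> R) (F G : (nat -> T) -> R).

Lemma coord_lip_le (k : nat) a b F : (forall i, (i < k)%N -> a i <= b i) ->
  coord_lip k a F -> coord_lip k b F.
Proof.
move=> ab FL x y; rewrite (le_trans (FL x y))//; apply: ler_sum => i _.
by rewrite ler_wpM2r ?mdist_ge0// ab.
Qed.

Lemma expR_sub_le (u v B : R) : u <= B -> expR u - expR v <= expR B * `|u - v|.
Proof.
move=> uB; apply: (@le_trans _ _ (expR u * (u - v))).
  have := ler_wpM2l (expR_ge0 u) (expR_ge1Dx (v - u)).
  by rewrite -expRD (addrC u) subrK => h; rewrite -subr_ge0; move: h; lra.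
rewrite (le_trans (ler_wpM2l (expR_ge0 u) (ler_norm _)))//.
by rewrite ler_wpM2r// ler_expR.
Qed.

(** The exponential is Lipschitz on the bounded range of [F].  This makes the
    tower property applicable to [exp (l F)], whatever the weights. *)
Lemma coord_lip_expR (k : nat) a F (l : R) : (forall i, 0 < a i) -> 0 < l ->
  coord_lip k a F ->
  exists2 b : nat -> R, (forall i, 0 < b i) &
    coord_lip k b (fun x => expR (l * F x)).
Proof.
move=> a0 l0 FL.
have [M FM] := coord_lip_bounded dist_le1 (fun i => ltW (a0 i)) FL.
have lFM x : l * F x <= l * M.
  by rewrite ler_pM2l// (le_trans (ler_norm _)).
exists (fun i => expR (l * M) * l * a i).
  by move=> i; rewrite !mulr_gt0 ?expR_gt0.
move=> x y.
under eq_bigr do rewrite -mulrA.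
rewrite -mulr_sumr.
apply: (@le_trans _ _ (expR (l * M) * `|l * F x - l * F y|)).
  rewrite ler_norml expR_sub_le// andbT lerNl opprB distrC.
  exact: expR_sub_le.
rewrite -mulrA ler_wpM2l ?expR_ge0// -mulrBr normrM (gtr0_norm l0).
by rewrite ler_pM2l.
Qed.

Hypothesis kappa_lt1 : kappa < 1.
Variables (alpha c : R).
Hypotheses (alpha_gt0 : 0 < alpha) (alpha_c : alpha + kappa * c <= c).

Let c_gt0 : 0 < c.
Proof.
have : 0 < (1 - kappa) * c.
  by rewrite (lt_le_trans alpha_gt0)// mulrBl mul1r lerBrDr.
by rewrite pmulr_rgt0// subr_gt0.
Qed.

(** The profile of weights preserved by averaging: the dependence on all that
    follows is carried by the newest coordinate [k], through the Markov
    property. *)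
Let weight (k i : nat) : R := if i == k then c else alpha.

Let weight_gt0 k i : 0 < weight k i.
Proof. by rewrite /weight; case: ifP. Qed.

Let weight_ge0 k i : 0 <= weight k i. Proof. exact: ltW. Qed.

Lemma next_mean_weight (k : nat) F : coord_lip k.+2 (weight k.+1) F ->
  coord_lip k.+1 (weight k) (next_mean P k F).
Proof.
move=> /(next_mean_lip dist_le1 contraction (weight_gt0 k.+1)).
apply: coord_lip_le => i ik; rewrite /weight eqxx (ltn_eqF (ltnSn k)).
by case: ifP => // _; rewrite (ltn_eqF ik).
Qed.

Lemma next_mean_mgf (k : nat) F (l : R) x : 0 <= l ->
  coord_lip k.+2 (weight k.+1) F ->
  next_mean P k (fun x => expR (l * F x)) x <=
  expR (l * next_mean P k F x + (l * c) ^+ 2 / 8).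
Proof.
move=> l0 FL; apply: hoeffding_mgf => //; first exact: prob_kernel.
  exact: measurable_coord_lip_upd FL.
move=> y y'; rewrite (le_trans (ler_norm _))// (le_trans (coord_lip_upd _ _ _ FL))//.
by rewrite /weight eqxx -[leRHS]mulr1 ler_wpM2l// ltW.
Qed.

Context {d' : measure_display} {O : measurableType d'} {Pr : probability O R}.
Variable X : nat -> {RV Pr >-> T}.
Hypothesis chainX : markov_chain P X.

Let path w : nat -> T := X ^~ w.

Let Pr1 : Pr setT = 1%E. Proof. exact: probability_setT. Qed.

(** One factor of Hoeffding's lemma per coordinate.  In the base case there is
    no kernel: the lemma is applied to the law of [X 0], which is arbitrary. *)
Lemma markov_mgf (k : nat) F (l : R) : 0 < l ->
  coord_lip k.+1 (weight k) F ->
  \int[Pr]_w expR (l * F (path w)) <=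
  expR (l * \int[Pr]_w F (path w) + k.+1%:R * ((l * c) ^+ 2 / 8)).
Proof.
move=> l0; elim: k F => [|k IH] F FL.
  rewrite mul1r; apply: hoeffding_mgf => //; first exact: ltW.
    exact: measurable_path (weight_ge0 0) FL.
  move=> w w'; have := coord_lip_oscillation dist_le1 (weight_ge0 0) FL (path w) (path w').
  by rewrite big_ord1.
have AL := next_mean_weight FL.
have [b b0 EL] := coord_lip_expR (weight_gt0 _) l0 FL.
have [b' b'0 EAL] := coord_lip_expR (weight_gt0 _) l0 AL.
rewrite (disintegration dist_le1 kappa_ge0 contraction chainX b0 EL).
rewrite (disintegration dist_le1 kappa_ge0 contraction chainX (weight_gt0 _) FL).
have iEA := integrable_path dist_le1 X (fun i => ltW (b'0 i)) EAL.
set v := (l * c) ^+ 2 / 8.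
have step w : next_mean P k (fun x => expR (l * F x)) (path w) <=
    expR v * expR (l * next_mean P k F (path w)).
  by rewrite -expRD addrC; apply: next_mean_mgf => //; exact: ltW.
apply: (@le_trans _ _ (\int[Pr]_w (expR v * expR (l * next_mean P k F (path w))))).
  apply: le_Rintegral => //; last by move=> w _; exact: step.
    have NL := next_mean_lip dist_le1 contraction b0 EL.
    apply: (integrable_path dist_le1 X _ NL) => i.
    by case: ifP => // _; rewrite ?addr_ge0 ?mulr_ge0// ltW.
  exact: (integrableZl measurableT _ iEA).
rewrite RintegralZl//.
apply: (le_trans (ler_wpM2l (expR_ge0 v) (IH _ AL))).
by rewrite -expRD -(natr1 k.+1) mulrDl mul1r addrCA (addrC v).
Qed.

(** A McDiarmid inequality: [c] is any bound on the geometric accumulation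
    of the weight [alpha], as [alpha + kappa * c <= c] expresses. *)
Lemma markov_concentration (n : nat) F (t : R) : (0 < n)%N -> 0 <= t ->
  coord_lip n (fun=> alpha) F ->
  (Pr [set w | (\int[Pr]_w' F (path w') + t <= F (path w))%R] <=
   (expR (- (2 * t ^+ 2 / (n%:R * c ^+ 2))))%:E)%E.
Proof.
case: n => // n _ t0 FL'.
have FL : coord_lip n.+1 (weight n) F.
  apply: coord_lip_le FL' => i _; rewrite /weight; case: ifP => // _.
  by rewrite (le_trans _ alpha_c)// lerDl mulr_ge0// ltW.
have mF := measurable_path X (weight_ge0 n) FL.
have [->|tN0] := eqVneq t 0.
  rewrite expr0n mulr0 mul0r oppr0 expR0; apply: probability_le1.
  rewrite -[X in measurable X]setTI.
  by apply: measurable_fun_le.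
have {t0 tN0} t0 : 0 < t by rewrite lt_neqAle eq_sym tN0.
pose mf := isMeasurableFun.Build _ _ _ _ _ mF.
pose Y : {RV Pr >-> R} := HB.pack (fun w => F (path w)) mf.
have N0 : 0 < n.+1%:R * c ^+ 2 by rewrite mulr_gt0// exprn_gt0.
(* the minimizer of [n * (l * c) ^+ 2 / 8 - l * t] *)
pose l := 4 * t / (n.+1%:R * c ^+ 2).
have l0 : 0 < l by rewrite divr_gt0// mulr_gt0.
apply: (le_trans (chernoff Y _ l0)).
have [b b0 EL] := coord_lip_expR (weight_gt0 _) l0 FL.
have iE := integrable_path dist_le1 X (fun i => ltW (b0 i)) EL.
rewrite /mmt_gen_fun unlock /=.
under eq_integral do rewrite mulrC.
rewrite -[X in (X * _)%E]fineK; last exact: integrable_fin_num iE.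
rewrite -EFinM lee_fin.
apply: (le_trans (ler_wpM2r (expR_ge0 _) (markov_mgf l0 FL))).
rewrite -expRD ler_expR le_eqVlt; apply/orP; left; apply/eqP.
rewrite /l; have : c != 0 by rewrite gt_eqF.
have : (n.+1%:R : R) != 0 by rewrite pnatr_eq0.
set I := \int[_]_w _.
move: (n.+1%:R : R) I c => N I C NN0 C0; field.
by rewrite NN0 C0.
Qed.

End concentration.

(** * The distance to the empirical measure *)

Section empirical_distance.
Context {d : measure_display} {R : realType} {T : polishType d R}.
Hypothesis dist_le1 : forall x y : T, mdist x y <= 1.

Lemma Lip1_measurable (f : T -> R) : Lip1 T f -> measurable_fun setT f.
Proof.
by move=> fL; apply: (measurable_lipschitz ler01) => x y; rewrite mul1r; exact: fL.
Qed.

Lemma Lip1_bounded (f : T -> R) : Lip1 T f -> forall x, `|f x| <= `|f point| + 1.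
Proof.
move=> fL; apply: (lip_bounded dist_le1 ler01) => x y.
by rewrite mul1r; exact: fL.
Qed.

Lemma Lip1_integrable (m : {measure set T -> \bar R}) (f : T -> R) :
  m setT = 1%E -> Lip1 T f -> m.-integrable setT (EFin \o f).
Proof.
move=> m1 fL; apply: (integrable_of_bounded m1 (Lip1_measurable fL)).
exact: Lip1_bounded.
Qed.

Lemma Lip1_mean_near (m : {measure set T -> \bar R}) (f : T -> R) (z : T) :
  m setT = 1%E -> Lip1 T f -> `|\int[m]_x f x - f z| <= 1.
Proof.
move=> m1 fL; have if_ := Lip1_integrable m1 fL.
have ic c : m.-integrable setT (EFin \o (fun _ : T => c)).
  by apply: (@integrable_of_bounded _ _ _ _ m1 _ `|c|).
have f1 x : `|f x - f z| <= 1 by rewrite (le_trans (fL x z)).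
rewrite -[X in _ - X](Rintegral_prob_cst m1) -RintegralB//.
have iB := integrableB measurableT if_ (ic (f z)).
rewrite (le_trans (le_normr_Rintegral measurableT iB))//.
rewrite -[leRHS](Rintegral_prob_cst m1); apply: le_Rintegral => //.
exact: (integrable_norm iB).
Qed.

Lemma empirical_setT (n : nat) (x : nat -> T) : (0 < n)%N ->
  empirical n x setT = 1%E.
Proof.
move=> n0; rewrite /empirical/= /mscale/= /msum/=.
under eq_bigr do rewrite diracT.
rewrite sumEFin sumr_const card_ord -EFinM mulVf// pnatr_eq0.
by rewrite -lt0n.
Qed.

(** Adding a bound of [|f|] reduces to a nonnegative integrand, for which
    integration is additive and homogeneous in the measure. *)
Lemma Rintegral_empirical (n : nat) (x : nat -> T) (f : T -> R) : (0 < n)%N ->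
  Lip1 T f -> \int[empirical n x]_y f y = n%:R^-1 * \sum_(i < n) f (x i.+1).
Proof.
move=> n0 fL; have e1 := empirical_setT x n0.
pose M := `|f point| + 1; pose g y := f y + M.
have if_ := Lip1_integrable e1 fL.
have ic : (empirical n x).-integrable setT (EFin \o (fun _ : T => M)).
  by apply: (@integrable_of_bounded _ _ _ _ e1 _ `|M|).
have g0 y : 0 <= g y.
  by have := Lip1_bounded fL y; rewrite /g /M ler_norml => /andP[]; lra.
have mg : measurable_fun setT g.
  by apply: measurable_funD => //; exact: Lip1_measurable.
have : \int[empirical n x]_y g y = n%:R^-1 * \sum_(i < n) g (x i.+1).
  rewrite /Rintegral ge0_integral_mscale//=; last 2 first.
  - exact/measurable_EFinP.
  - by move=> y _; rewrite lee_fin.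
  rewrite ge0_integral_measure_sum//=; last 2 first.
  - by move=> y _; rewrite lee_fin.
  - exact/measurable_EFinP.
  under eq_bigr => i _.
    rewrite integral_dirac//; last exact/measurable_EFinP.
    rewrite diracT mul1e.
    over.
  by rewrite sumEFin.
rewrite /g RintegralD// Rintegral_prob_cst// big_split/= sumr_const card_ord.
rewrite mulrDr -[M *+ n]mulr_natl mulKf ?pnatr_eq0 -?lt0n//.
exact: addIr.
Qed.

(** Each [|mu f - mu_n f|] varies by at most the average of the [d(x_i, y_i)],
    hence so does the supremum.  The empirical measure reads the coordinates
    from 1 on; the predecessor shifts them to start at 0. *)
Lemma dS_lip (S : set (T -> R)) (mu : {measure set T -> \bar R}) (n : nat) :
  mu setT = 1%E -> (0 < n)%N -> S `<=` Lip1 T ->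
  coord_lip n (fun=> n%:R^-1) (fun x : nat -> T => dS S mu (empirical n (x \o predn))).
Proof.
move=> mu1 n0 SL.
pose D (x : nat -> T) := dS S mu (empirical n (x \o predn)).
suff le x y : D x - D y <= \sum_(i < n) n%:R^-1 * mdist (x i) (y i).
  move=> x y; rewrite ler_norml le andbT lerNl opprB.
  under eq_bigr do rewrite metric_sym.
  exact: le.
rewrite /D /dS; have [->|S0] := eqVneq S set0.
  rewrite !image_set0 sup0 subrr; apply: sumr_ge0 => i _.
  by rewrite mulr_ge0 ?invr_ge0 ?mdist_ge0 ?ler0n.
move/set0P : S0 => [f0 Sf0].
rewrite lerBlDl; apply: ge_sup; first by eexists; exists f0.
move=> _ [f Sf <-]; have fL := SL _ Sf.
set I := \int[mu]_z f z.
have step : `|\int[empirical n (y \o predn)]_z f z -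
    \int[empirical n (x \o predn)]_z f z| <= \sum_(i < n) n%:R^-1 * mdist (x i) (y i).
  rewrite !Rintegral_empirical// -mulrBr normrM ger0_norm ?invr_ge0//.
  rewrite -mulr_sumr ler_wpM2l ?invr_ge0// -sumrB (le_trans (ler_norm_sum _ _ _))//.
  by apply: ler_sum => i _ /=; rewrite distrC; exact: fL.
apply: (le_trans (ler_distD (\int[empirical n (y \o predn)]_z f z) _ _)).
apply: lerD => //; apply: ub_le_sup; last by exists f.
(* both means of [g] are within 1 of [g point], by the diameter bound *)
exists 2 => _ [g Sg <-]; have gL := SL _ Sg.
apply: (le_trans (ler_distD (g point) _ _)).
rewrite [leRHS](_ : 2 = 1 + 1)//; apply: lerD; first exact: Lip1_mean_near.
rewrite distrC; apply: Lip1_mean_near => //; exact: empirical_setT.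
Qed.

End empirical_distance.

(** * The main inequality *)

Section markov_chain_facts.
Context {d : measure_display} {R : realType} {T : polishType d R}.

Lemma W1_kiter1 (P : R.-pker T ~> T) (x y : T) :
  W1 (kiter P 1 x) (kiter P 1 y) = W1 (P x) (P y).
Proof.
have kE z A : measurable A -> kiter P 1 z A = P z A.
  move=> mA; rewrite /= /mkcomp_noparam /kcomp_noparam /kdirac/=.
  by rewrite integral_indic// setIT.
rewrite /W1; congr (ereal_inf (_ @` _)); apply/seteqP.
by split => pi [h1 h2]; split => A mA; rewrite ?h1 ?h2// kE.
Qed.

Lemma markov_chain_shift d' (O : measurableType d') (Pr : probability O R)
    (P : R.-pker T ~> T) (X : nat -> {RV Pr >-> T}) :
  markov_chain P X -> markov_chain P (fun i => X i.+1).
Proof.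
move=> chainX n H A pH mA; apply: chainX => //.
apply: smallest_sub pH; first exact: smallest_sigma_algebra.
move=> _ [i /= i_n [B mB <-]]; apply: sub_sigma_algebra.
by exists i.+1 => //; exists B.
Qed.

End markov_chain_facts.

Local Open Scope ereal_scope.

Theorem theorem1p5 (R : realType)
  (d : measure_display) (T : polishType d R) (diamT : diameter T <= 1)
  (kappa : R) (kappa01 : (0 < kappa < 1)%R)
  (P : R.-pker T ~> T)
  (contraction : forall n : nat, (0 < n)%N -> forall x y : T,
     W1 (kiter P n x) (kiter P n y) <= (kappa ^+ n * mdist x y)%:E)
  (d' : measure_display) (Omega : measurableType d') (Pr : probability Omega R)
  (X : nat -> {RV Pr >-> T}) (chainX : markov_chain P X)
  (mu : probability T R) (invmu : invariant_measure P mu)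
  (S : set (T -> R)) (SLip : S `<=` Lip1 T)
  (n : nat) (n_gt0 : (0 < n)%N) (t : R) (t_ge0 : (0 <= t)%R) :
  let D := fun w : Omega => dS S mu (empirical n (fun i => X i w)) in
  Pr [set w | 'E_Pr[D] + t%:E <= (D w)%:E]
    <= (expR (- 2 * (1 - kappa) ^+ 2 * n%:R * t ^+ 2))%:E.
Proof.
lazy zeta; set D := fun w : Omega => dS _ _ _.
have /andP[kappa_gt0 kappa_lt1] := kappa01.
have dist_le1 (x y : T) : (mdist x y <= 1)%R.
  rewrite -lee_fin (le_trans _ diamT)//.
  by apply: ereal_sup_ubound; exists (x, y).
have contr x y : (W1 (P x) (P y) <= (kappa * mdist x y)%:E)%E.
  by rewrite -W1_kiter1 -{1}[kappa]expr1; exact: contraction.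
have mu1 : mu setT = 1%E by exact: probability_setT.
have FL := dS_lip dist_le1 mu1 n_gt0 SLip.
have n0 : (0 < n%:R :> R)%R by rewrite ltr0n.
have a0 : (0 < n%:R^-1 :> R)%R by rewrite invr_gt0.
have k1 : (0 < 1 - kappa)%R by rewrite subr_gt0.
(* the sum of the geometric series [alpha * kappa ^+ i] with [alpha = 1 / n] *)
pose c : R := (n%:R^-1 / (1 - kappa))%R.
have ac : (n%:R^-1 + kappa * c <= c)%R.
  rewrite le_eqVlt; apply/orP; left; apply/eqP; rewrite /c.
  by field; rewrite !gt_eqF.
have chainY := markov_chain_shift chainX.
have := markov_concentration dist_le1 (ltW kappa_gt0) contr kappa_lt1 a0 ac chainY
  n_gt0 t_ge0 FL.
have iD := integrable_path dist_le1 (fun i => X i.+1) (fun=> ltW a0) FL.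
have -> : 'E_Pr[D] = (\int[Pr]_w D w)%R%:E.
  by rewrite unlock fineK//; exact: integrable_fin_num iD.
suff -> : (- 2 * (1 - kappa) ^+ 2 * n%:R * t ^+ 2 = - (2 * t ^+ 2 / (n%:R * c ^+ 2)))%R.
  by [].
by rewrite /c; field; rewrite !gt_eqF.
Qed.
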